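(* For the class of multitype (mixed-autonomy) congestion games with affine latency functions $c_i(z_i)=\sum_{j\in[m]}a_i^jz_i^j+b_i$ and maximum degree of asymmetry $k$, the Price of Anarchy with variable marginal cost tolls $$\tau_i^j(z_i)=\Big(\sum_{l\in[m]}z_i^l\Big)\frac{\partial}{\partial z_i^j}c_i(z_i)$$ applied is at least $$\frac{k}{2\sqrt k-1}.$$
   Context: Network: a finite directed graph (parallel edges allowed) with $n$ edges (roads), indexed by $i\in[n]=\{1,\dots,n\}$; there are $m$ vehicle types indexed by $j\in[m]$ ($n$ and $m$ may vary between instances). Flow is nonatomic. Demand is inelastic and given by finitely many commodities $r\in[R]$, each with a source node $s_r$, destination node $s'_r$, demand $\beta_r\ge 0$ and vehicle type $j_r\in[m]$; $\mathcal P_r$ is the set of simple paths from $s_r$ to $s'_r$. A feasible path flow assigns $f_{r,p}\ge0$ to each $r\in[R]$, $p\in\mathcal P_r$ with $\sum_{p\in\mathcal P_r}f_{r,p}=\beta_r$. It induces the edge routing $z=(z_i^j)$, where $z_i^j=\sum_{r:\,j_r=j}\ \sum_{p\in\mathcal P_r:\,i\in p}f_{r,p}$ is the flow of type $j$ on road $i$. Write $z_i=(z_i^1,\dots,z_i^m)^T$. The set $\mathcal Z$ of feasible routings is the set of edge routings induced by feasible path flows. Latency: on road $i$ all vehicle types experience the same latency $c_i(z_i)=\sum_{j\in[m]}a_i^jz_i^j+b_i$ with $a_i^j\ge0$, $b_i\ge0$. Social cost (tolls not counted): $C(z)=\sum_{i\in[n]}\big(\sum_{j\in[m]}z_i^j\big)c_i(z_i)$.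 A socially optimal routing $z^*$ is a minimizer of $C$ over $\mathcal Z$. Wardrop Equilibrium with flow-dependent tolls: a feasible routing $z$, induced by a feasible path flow $f$, such that for all $r\in[R]$ and $p,p'\in\mathcal P_r$: $f_{r,p}>0$ implies $\sum_{i\in p}(c_i(z_i)+\tau_i^{j_r}(z_i))\le\sum_{i\in p'}(c_i(z_i)+\tau_i^{j_r}(z_i))$. Maximum degree of asymmetry: $k=\max_{i\in[n],\,j,j'\in[m]}a_i^j/a_i^{j'}$, so $k\ge1$ (ratio taken as $1$ on a road with all $a_i^j=0$). Price of Anarchy with tolls: the supremum, over all instances in the class with $C(z^* )>0$ and over all Wardrop Equilibria $\hat z$ under the tolls, of $C(\hat z)/C(z^* )$. *)

(* Defs.v *)
From mathcomp Require Import all_boot all_order all_algebra.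
From mathcomp Require Import all_classical all_reals all_analysis.
Import Order.TTheory GRing.Theory Num.Theory.
Import numFieldNormedType.Exports.

Set Implicit Arguments.
Unset Strict Implicit.
Unset Printing Implicit Defensive.

Local Open Scope classical_set_scope.
Local Open Scope ring_scope.

(* Roads are labelled by 'I_(nroads), so that parallel roads are allowed. *)
Record game (R : realType) := Game {
  node : finType;
  nroads : nat;
  ntypes : nat;
  ncomm : nat;
  source : 'I_nroads -> node;
  target : 'I_nroads -> node;
  slope : 'I_nroads -> 'I_ntypes -> R;
  offset : 'I_nroads -> R;
  origin : 'I_ncomm -> node;
  dest : 'I_ncomm -> node;
  demand : 'I_ncomm -> R;
  vtype : 'I_ncomm -> 'I_ntypes;
  slope_ge0 : forall i j, 0 <= slope i j;
  offset_ge0 : forall i, 0 <= offset i;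
  demand_ge0 : forall r, 0 <= demand r
}.

Section Routing.
Context {R : realType} (G : game R).

(* The bound on the length excludes no simple path: a sequence of roads that
   visits no node twice uses no road twice. *)
Definition roadpath := (nroads G).-bseq 'I_(nroads G).

(* The nodes visited by p from s are s :: map target p; each road must leave from
   the node reached so far. If s = t the only simple path is the empty one. *)
Definition simple_path (s t : node G) (p : roadpath) : bool :=
  [&& map (@source _ G) p == belast s (map (@target _ G) p),
      last s (map (@target _ G) p) == t &
      uniq (s :: map (@target _ G) p)].

Definition comm_path (r : 'I_(ncomm G)) (p : roadpath) : bool :=
  simple_path (origin r) (dest r) p.

(* Only the values f r p with comm_path r p are meaningful. *)
Definition pathflow := 'I_(ncomm G) -> roadpath -> R.

Definition feasible_flow (f : pathflow) : Prop :=
  (forall r p, comm_path r p -> 0 <= f r p) /\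
  (forall r, \sum_(p : roadpath | comm_path r p) f r p = demand r).

Definition routing := 'M[R]_(nroads G, ntypes G).

Definition induced_routing (f : pathflow) : routing :=
  \matrix_(i, j) \sum_(r | vtype r == j)
     \sum_(p : roadpath | comm_path r p && (i \in p)) f r p.

Definition feasible : set routing :=
  [set z | exists2 f, feasible_flow f & z = induced_routing f].

Definition latency (i : 'I_(nroads G)) (zi : 'rV[R]_(ntypes G)) : R :=
  \sum_j slope i j * zi 0 j + offset i.

Definition social_cost (z : routing) : R :=
  \sum_i (\sum_j z i j) * latency i (row i z).

Definition socially_optimal (z : routing) : Prop :=
  feasible z /\ forall z', feasible z' -> social_cost z <= social_cost z'.

Definition tolls := 'I_(nroads G) -> 'I_(ntypes G) -> 'rV[R]_(ntypes G) -> R.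

Definition path_cost (tau : tolls) (z : routing) (j : 'I_(ntypes G))
    (p : roadpath) : R :=
  \sum_(i <- p) (latency i (row i z) + tau i j (row i z)).

Definition wardrop_equilibrium (tau : tolls) (z : routing) : Prop :=
  exists f, [/\ feasible_flow f, z = induced_routing f &
    forall r p p', comm_path r p -> comm_path r p' -> 0 < f r p ->
      path_cost tau z (vtype r) p <= path_cost tau z (vtype r) p'].

(* delta_mx 0 j is the j-th unit vector, so this derivative is the partial
   derivative of the latency with respect to the flow of type j. *)
Definition marginal_cost_tolls : tolls := fun i j zi =>
  (\sum_l zi 0 l) * 'D_(delta_mx 0 j) (latency i) zi.

(* Extended-real division: a / 0 = +oo for a > 0, so the degree of asymmetry is
   infinite when a road has both a zero and a nonzero slope. On such a road
   0 / 0 = 0, which does not affect the maximum. *)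
Definition slope_ratio (i : 'I_(nroads G)) (j j' : 'I_(ntypes G)) : \bar R :=
  if [forall l, slope i l == 0] then 1%E
  else ((slope i j)%:E / (slope i j')%:E)%E.

(* The ratios with j = j' make the maximum at least 1; starting from 1 only
   matters for a game without roads or without types. *)
Definition max_asymmetry : \bar R :=
  \big[maxe/1%E]_(i < nroads G)
    \big[maxe/1%E]_(j < ntypes G)
      \big[maxe/1%E]_(j' < ntypes G) slope_ratio i j j'.

End Routing.

Definition price_of_anarchy (R : realType) (class : game R -> Prop)
    (tau : forall G : game R, tolls G) : \bar R :=
  ereal_sup [set x : \bar R | exists (G : game R) (zeq zopt : routing G),
    [/\ class G,
        wardrop_equilibrium (tau G) zeq,
        socially_optimal zopt,
        0 < social_cost zopt &
        x = (social_cost zeq / social_cost zopt)%:E]].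

(* Main.v *)
Require Import Defs.
From mathcomp Require Import all_boot all_order all_algebra.
From mathcomp Require Import all_classical all_reals all_analysis.
From mathcomp Require Import ring lra.
Import Order.TTheory GRing.Theory Num.Theory.
Import numFieldNormedType.Exports.

Set Implicit Arguments.
Unset Strict Implicit.
Unset Printing Implicit Defensive.

Local Open Scope ring_scope.

(** With marginal cost tolls, an equilibrium is merely a first-order stationary
    point of the social cost, which is not convex when the slopes of a road differ.
    Put g = 2k/(k+1) and take a line of nodes 0, ..., n, each with an exit road to
    the common destination and a free link to the next node. Commodity j < n starts
    at node j with its own type and demand g^-j; exit road l < n has slope k g^(2l)
    for type l and g^(2l) for the other types. If everybody takes the nearest exit,
    each commodity costs k. A user of type j then pays 2k g^j, and would pay
    (k+1) g^l at a later exit l > j, which is no less: this is an equilibrium. If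
    everybody moves one exit further, where its own slope is small, each commodity
    but the last costs only g^2. As n grows the ratio tends to
    k/g^2 = (k+1)^2/(4k), which is at least k/(2 sqrt k - 1). *)

(** * Marginal cost tolls and the existence of optimal routings *)

Lemma derive_latency (R : realType) (G : game R) (i : 'I_(nroads G))
    (j : 'I_(ntypes G)) (zi : 'rV[R]_(ntypes G)) :
  'D_(delta_mx 0 j) (latency i) zi = slope i j.
Proof.
(* The latency is affine, so the difference quotient equals the slope for every nonzero [h]; no
   limit has to be computed. *)
rewrite /derive; apply: cvg_lim => //; apply: cvg_near_cst.
near=> h; have h0 : h != 0 by near: h; exact: nbhs_dnbhs_neq.
have -> : latency i (h *: delta_mx 0 j + zi) - latency i zi = h * slope i j.
  rewrite /latency opprD addrACA subrr addr0 -sumrB (bigD1 j)//= !mxE !eqxx.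
  rewrite big1 => [|l lj]; first by rewrite mulr1 addr0; ring.
  by rewrite !mxE eqxx (negPf lj) mulr0 add0r subrr.
by rewrite /GRing.scale/= mulKf.
Unshelve. all: by end_near. Qed.

Lemma continuous_sum_fun (R : realType) (T : topologicalType) (I : Type) (s : seq I)
    (P : pred I) (F : I -> T -> R) :
  (forall i, P i -> continuous (F i)) ->
  continuous (fun x => \sum_(i <- s | P i) F i x).
Proof.
move=> Fc; elim: s => [|i s IHs] x.
  by under eq_fun do rewrite big_nil; exact: cvg_cst.
under eq_fun do rewrite big_cons.
case: ifPn => [Pi|_]; last exact: IHs.
by apply: continuousD; [exact: Fc | exact: IHs].
Qed.

Lemma continuous_total_cost (R : realType) (T : topologicalType) (I J : finType)
    (z : T -> I -> J -> R) (a : I -> J -> R) (b : I -> R) :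
  (forall i j, continuous (fun x => z x i j)) ->
  continuous (fun x => \sum_i (\sum_j z x i j) * (\sum_j a i j * z x i j + b i)).
Proof.
move=> zc; apply: continuous_sum_fun => i _ x; apply: cvgM.
  by apply: continuous_sum_fun => j _; exact: zc.
apply: cvgD; last exact: cvg_cst.
apply: continuous_sum_fun => j _ y.
by apply: cvgM; [exact: cvg_cst | exact: zc].
Qed.

(** The cost is continuous in the path flow, and path flows range over a compact set: a box, compact
    by Tychonoff, cut by the closed demand constraints. This supplies the optimum that the price of
    anarchy asks for without computing it. *)
Lemma exists_socially_optimal (R : realType) (G : game R) (z0 : routing G) :
  feasible z0 -> exists z : routing G, socially_optimal z.
Proof.
move=> [f0 f0P _].
pose I := ('I_(ncomm G) * roadpath G)%type.
pose T := prod_topology (fun _ : I => R).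
pose flow (x : T) : pathflow G := fun r p => x (r, p).
(* Values off the paths of a commodity are unconstrained in [feasible_flow];
   they are reset to 0 to land in a compact box. *)
pose ext (f : pathflow G) : T :=
  fun rp => if comm_path rp.1 rp.2 then f rp.1 rp.2 else 0.
have flowc r p : continuous (fun x => flow x r p).
  exact: (@proj_continuous I (fun=> R) (r, p)).
pose K : set T := fun x : I -> R => forall rp, `[0, demand rp.1]%classic (x rp).
pose S : set T := (\bigcap_(r in [set: 'I_(ncomm G)])
   [set x : T | \sum_(p | comm_path r p) flow x r p = demand r])%classic.
have Kc : compact K.
  by apply: (@tychonoff I (fun=> R) (fun rp => `[0, demand rp.1]%classic)) => rp;
    exact: segment_compact.
have Sc : closed S.
  apply: closed_bigI => r _.
  have := @closed_comp _ _ (fun x => \sum_(p | comm_path r p) flow x r p)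
     [set demand r]%classic.
  apply; last exact: closed_eq.
  move=> x _; apply: continuous_sum_fun => p _; exact: flowc.
have extP f : feasible_flow f ->
    (S `&` K)%classic (ext f) /\ induced_routing (flow (ext f)) = induced_routing f.
  move=> [f_ge0 f_sum]; split; last first.
    apply/matrixP => i j; rewrite !mxE; apply: eq_bigr => r _.
    by apply: eq_bigr => p /andP[pr _]; rewrite /flow /ext /= pr.
  split.
    move=> r _ /=; rewrite -f_sum; apply: eq_bigr => p pr.
    by rewrite /flow /ext /= pr.
  move=> [r p]; rewrite /= in_itv/= /ext /=; case: ifPn => pr.
    rewrite f_ge0//= -f_sum (bigD1 p)//= lerDl sumr_ge0// => q /andP[+ _].
    exact: f_ge0.
  by rewrite lexx demand_ge0.
have SKc : compact (S `&` K)%classic.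
  by rewrite setIC; apply: compact_closedI.
have zc i j : continuous (fun x => induced_routing (flow x) i j).
  rewrite (_ : (fun x => _) = fun x => \sum_(r | vtype r == j)
     \sum_(p : roadpath G | comm_path r p && (i \in p)) flow x r p).
    by apply: continuous_sum_fun => r _; apply: continuous_sum_fun.
  by apply/funext => x; rewrite mxE.
pose z x i j : R := induced_routing (flow x) i j.
pose cost x := \sum_i (\sum_j z x i j) * (\sum_j slope i j * z x i j + offset i).
have costE x : social_cost (induced_routing (flow x)) = cost x.
  apply: eq_bigr => i _; congr (_ * (_ + _)).
  by apply: eq_bigr => j _; rewrite mxE.
have costc : continuous cost.
  exact: (@continuous_total_cost R T _ _ z (@slope _ G) (@offset _ G) zc).
have [|x] := compact_EVT_min _ SKc (continuous_subspaceT costc).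
  by exists (ext f0); apply: (extP _ f0P).1.
rewrite inE => -[Sx Kx] xmin; exists (induced_routing (flow x)); split.
  exists (flow x) => //; split => [r p _|r]; last exact: Sx.
  by have := Kx (r, p); rewrite /= in_itv/= => /andP[].
rewrite costE => z' [f fP ->]; have [SKf <-] := extP f fP.
by rewrite costE; apply: xmin; rewrite inE.
Qed.

Lemma path_cost_marginal (R : realType) (G : game R) (z : routing G)
    (j : 'I_(ntypes G)) (p : roadpath G) :
  path_cost (@marginal_cost_tolls R G) z j p =
  \sum_(i <- p) (latency i (row i z) + (\sum_l z i l) * slope i j).
Proof.
apply: eq_bigr => i _; rewrite /marginal_cost_tolls derive_latency.
by congr (_ + _ * _); apply: eq_bigr => l _; rewrite mxE.
Qed.

(** * Flows that send each commodity along a single path *)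

Section PureFlow.
Context {R : realType} {G : game R} (P : 'I_(ncomm G) -> roadpath G).
Hypothesis comm_pathP : forall r, comm_path r (P r).

Definition pure_flow : pathflow G := fun r p => if p == P r then demand r else 0.

Lemma feasible_pure_flow : feasible_flow pure_flow.
Proof.
split=> [r p _|r]; first by rewrite /pure_flow; case: ifP => // _; exact: demand_ge0.
rewrite (bigD1 (P r))//= /pure_flow eqxx big1 ?addr0// => p /andP[_ /negPf->].
by [].
Qed.

Lemma induced_pure_flow i j : induced_routing pure_flow i j =
  \sum_(r | (vtype r == j) && (i \in P r)) demand r.
Proof.
rewrite mxE big_mkcondr; apply: eq_bigr => r _; rewrite /pure_flow.
case: ifPn => iP.
  rewrite (bigD1 (P r)) ?comm_pathP//= eqxx big1 ?addr0// => p.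
  by case/andP => _ /negPf->.
by apply: big1 => p /andP[_ ip]; case: eqP => // pP; rewrite -pP ip in iP.
Qed.

End PureFlow.

(** Serves to bound the cost of advancing, where only the last commodity is exceptional. It is an
    inequality because for [n = 0] the sum is empty while [y] remains on the right. *)
Lemma sum_ord_if_last (R : numDomainType) (n : nat) (x y : R) : 0 <= x -> 0 <= y ->
  \sum_(j < n) (if (j.+1 < n)%N then x else y) <= n%:R * x + y.
Proof.
case: n => [|n] x_ge0 y_ge0; first by rewrite big_ord0 mul0r add0r.
rewrite big_ord_recr/= ltnn lerD2r.
under eq_bigr do rewrite ltnS ltn_ord.
by rewrite sumr_const card_ord mulr_natl ler_wpMn2l.
Qed.

Lemma sum_ord_if_eq (R : nmodType) (n : nat) (i : 'I_n) (F : 'I_n -> R) :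
  \sum_(j < n) (if i == j :> nat then F j else 0) = F i.
Proof. by rewrite -big_mkcond (big_pred1 i)// => j; rewrite eq_sym. Qed.

(** * The chain game *)

Section Chain.
Context {R : realType} (k : R) (n : nat) (k_ge1 : 1 <= k).

(** The value solves (k + 1) g = 2k: the marginal cost 2k g^j at one's own exit then equals the
    marginal cost (k + 1) g^(j+1) at the next one, so staying is just barely an equilibrium. *)
Definition growth : R := 2 * k / (k + 1).
Local Notation g := growth.

(** Nodes: [None] is the common destination, [Some l] the l-th node of the line. Roads: the left
    summand of the index holds the n + 1 exits, the right one the n links. *)
Definition chain_source (i : 'I_(n.+1 + n)) : option 'I_n.+1 :=
  match fintype.split i with
  | inl l => Some l
  | inr j => Some (widen_ord (leqnSn n) j)
  end.

Definition chain_target (i : 'I_(n.+1 + n)) : option 'I_n.+1 :=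
  match fintype.split i with inl l => None | inr j => Some (lift ord0 j) end.

Definition chain_slope (i : 'I_(n.+1 + n)) (j : 'I_n) : R :=
  match fintype.split i with
  | inl l => if (l < n)%N then (if l == j :> nat then k else 1) * g ^+ l ^+ 2 else 0
  | inr _ => 0
  end.

(* The last exit road has no commodity of its own; its constant latency is the
   marginal cost (k + 1) g^l of the other exits, continued to l = n. *)
Definition chain_offset (i : 'I_(n.+1 + n)) : R :=
  match fintype.split i with
  | inl l => if (l < n)%N then 0 else (k + 1) * g ^+ n
  | inr _ => 0
  end.

Lemma growth_ge1 : 1 <= g.
Proof. by rewrite /growth ler_pdivlMr; move: k_ge1; lra. Qed.

Lemma growth_gt0 : 0 < g. Proof. exact: lt_le_trans growth_ge1. Qed.

Lemma growthX_gt0 m : 0 < g ^+ m. Proof. by rewrite exprn_gt0 ?growth_gt0. Qed.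

Let k_gt0 : 0 < k. Proof. by move: k_ge1; lra. Qed.

Lemma k1_growth : (k + 1) * g = 2 * k.
Proof. by rewrite /growth; field; move: k_ge1; lra. Qed.

Lemma chain_slope_ge0 i j : 0 <= chain_slope i j.
Proof.
rewrite /chain_slope; case: fintype.split => // l; case: ifP => // _.
by rewrite mulr_ge0 ?exprn_ge0 ?(ltW growth_gt0)//;
  case: ifP => _; rewrite ?(ltW k_gt0).
Qed.

Lemma chain_offset_ge0 i : 0 <= chain_offset i.
Proof.
rewrite /chain_offset; case: fintype.split => // l; case: ifP => // _.
by rewrite mulr_ge0 ?(ltW (growthX_gt0 _))//; move: k_ge1; lra.
Qed.

Lemma chain_demand_ge0 (j : 'I_n) : 0 <= (g ^+ j)^-1.
Proof. by rewrite invr_ge0 ltW ?growthX_gt0. Qed.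

Definition chain : game R :=
  @Game R _ _ n n chain_source chain_target chain_slope chain_offset
    (fun j => Some (widen_ord (leqnSn n) j)) (fun=> None) (fun j => (g ^+ j)^-1) id
    chain_slope_ge0 chain_offset_ge0 chain_demand_ge0.

(** * Roads and paths of the chain *)

Definition exit_road (l : 'I_n.+1) : 'I_(nroads chain) := lshift n l.
Definition link (j : 'I_n) : 'I_(nroads chain) := rshift n.+1 j.

Lemma split_exit l : fintype.split (exit_road l) = inl l.
Proof. exact: (unsplitK (inl l)). Qed.

Lemma split_link j : fintype.split (link j) = inr j.
Proof. exact: (unsplitK (inr j)). Qed.

Lemma exit_link_neq l j : (exit_road l == link j) = false.
Proof. exact: eq_lrshift. Qed.

Lemma exit_eq l l' : (exit_road l == exit_road l') = (l == l').
Proof. exact: eq_lshift. Qed.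

Lemma slope_exit l j : chain_slope (exit_road l) j =
  if (l < n)%N then (if l == j :> nat then k else 1) * g ^+ l ^+ 2 else 0.
Proof. by rewrite /chain_slope split_exit. Qed.

Lemma offset_exit l : chain_offset (exit_road l) =
  if (l < n)%N then 0 else (k + 1) * g ^+ n.
Proof. by rewrite /chain_offset split_exit. Qed.

Lemma slope_link j j' : chain_slope (link j) j' = 0.
Proof. by rewrite /chain_slope split_link. Qed.

Lemma offset_link j : chain_offset (link j) = 0.
Proof. by rewrite /chain_offset split_link. Qed.

Lemma source_exit l : chain_source (exit_road l) = Some l.
Proof. by rewrite /chain_source split_exit. Qed.

Lemma target_exit l : chain_target (exit_road l) = None.
Proof. by rewrite /chain_target split_exit. Qed.

Lemma source_link j : chain_source (link j) = Some (widen_ord (leqnSn n) j).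
Proof. by rewrite /chain_source split_link. Qed.

Lemma target_link j : chain_target (link j) = Some (lift ord0 j).
Proof. by rewrite /chain_target split_link. Qed.

(** Links only lead forward along the line and [None] is entered only through an exit, so induction
    on the walk finds an exit that does not lie behind its start. *)
Lemma walk_exit (v : 'I_n.+1) (s : seq 'I_(nroads chain)) :
  map chain_source s = belast (Some v) (map chain_target s) ->
  last (Some v) (map chain_target s) = None ->
  exists2 l : 'I_n.+1, exit_road l \in s & (v <= l)%N.
Proof.
elim: s v => [//|i s IHs] v /= [].
case: (split_ordP i) => l ->; rewrite -?/(exit_road l) -?/(link l).
  by rewrite source_exit => -[<-] _ _; exists l; rewrite ?inE ?eqxx.
rewrite source_link target_link => -[<-] /IHs{}IHs /IHs[l' l's ll']; exists l'.
  by rewrite inE l's orbT.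
by rewrite (leq_trans _ ll')//= /bump leq0n.
Qed.

Lemma comm_path_exit (r : 'I_(ncomm chain)) (p : roadpath chain) :
  comm_path r p -> exists2 l : 'I_n.+1, exit_road l \in p & (r <= l)%N.
Proof. by move=> /and3P[/eqP + /eqP + _]; exact: walk_exit. Qed.

Lemma exit_path_size (r : 'I_n) :
  (size [:: exit_road (widen_ord (leqnSn n) r)] <= nroads chain)%N.
Proof. by []. Qed.

Definition stay (r : 'I_(ncomm chain)) : roadpath chain :=
  @Bseq _ _ [:: exit_road (widen_ord (leqnSn n) r)] (exit_path_size r).

(** Two roads fit within the length bound because a commodity [r] exists only when n > 0. *)
Lemma advance_path_size (r : 'I_n) :
  (size [:: link r; exit_road (lift ord0 r)] <= nroads chain)%N.
Proof. by case: r => r /= rn; rewrite addSn ltnS addn_gt0 (leq_ltn_trans _ rn). Qed.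

Definition advance (r : 'I_(ncomm chain)) : roadpath chain :=
  @Bseq _ _ [:: link r; exit_road (lift ord0 r)] (advance_path_size r).

Lemma comm_path_stay r : comm_path r (stay r).
Proof.
by rewrite /comm_path /simple_path /= source_exit target_exit !eqxx.
Qed.

Lemma comm_path_advance r : comm_path r (advance r).
Proof.
rewrite /comm_path /simple_path /= source_exit target_exit source_link target_link.
rewrite !eqxx/= !inE/= orbF andbT.
by apply/eqP => -[]; rewrite /= /bump leq0n add1n; apply/eqP; rewrite ltn_eqF.
Qed.

(** * The two routings: flows, latencies and social costs *)

Local Notation wid := (widen_ord (leqnSn n)).

Definition stay_routing : routing chain := induced_routing (pure_flow stay).
Definition advance_routing : routing chain := induced_routing (pure_flow advance).

Lemma stay_exit l (j : 'I_n) :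
  stay_routing (exit_road l) j = if l == j :> nat then (g ^+ j)^-1 else 0.
Proof.
rewrite (induced_pure_flow comm_path_stay) big_mkcondr (big_pred1 j)//=.
by rewrite inE exit_eq.
Qed.

Lemma advance_exit (l : 'I_n.+1) (j : 'I_n) :
  advance_routing (exit_road l) j = if l == j.+1 :> nat then (g ^+ j)^-1 else 0.
Proof.
rewrite (induced_pure_flow comm_path_advance) big_mkcondr (big_pred1 j)//.
rewrite -[exit_road l \in _]/(exit_road l \in [:: link j; exit_road (lift ord0 j)]).
by rewrite !inE exit_link_neq exit_eq -val_eqE /= /bump leq0n add1n.
Qed.

Lemma latencyE (z : routing chain) i :
  latency i (row i z) = \sum_(j < n) chain_slope i j * z i j + chain_offset i.
Proof. by congr (_ + _); apply: eq_bigr => j _; rewrite mxE. Qed.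

Lemma latency_link (z : routing chain) i : latency (link i) (row (link i) z) = 0.
Proof.
rewrite latencyE offset_link addr0 big1// => j _.
by rewrite slope_link mul0r.
Qed.

Lemma stay_total j : \sum_(j' < n) stay_routing (exit_road (wid j)) j' = (g ^+ j)^-1.
Proof.
under eq_bigr do rewrite stay_exit.
exact: (sum_ord_if_eq j (fun j' => (g ^+ j')^-1)).
Qed.

Lemma stay_total_max : \sum_(j < n) stay_routing (exit_road ord_max) j = 0.
Proof. by apply: big1 => j _; rewrite stay_exit gtn_eqF. Qed.

Lemma stay_latency j :
  latency (exit_road (wid j)) (row (exit_road (wid j)) stay_routing) = k * g ^+ j.
Proof.
rewrite latencyE offset_exit /= ltn_ord addr0.
rewrite (eq_bigr (fun j' : 'I_n => if j == j' :> nat then k * g ^+ j' else 0))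
  => [|j' _]; first exact: sum_ord_if_eq.
rewrite stay_exit slope_exit /= ltn_ord.
case: eqP => [->|_]; last by rewrite mulr0.
by field; rewrite gt_eqF ?growthX_gt0.
Qed.

Lemma stay_latency_max :
  latency (exit_road ord_max) (row (exit_road ord_max) stay_routing) = (k + 1) * g ^+ n.
Proof.
rewrite latencyE offset_exit /= ltnn big1 ?add0r// => j _.
by rewrite slope_exit ltnn mul0r.
Qed.

Lemma ord_wid (l : 'I_n.+1) : l = ord_max \/ exists j, l = wid j.
Proof.
have [ln|nl] := ltnP l n; last first.
  by left; apply/val_inj/eqP; rewrite eqn_leq -ltnS ltn_ord.
by right; exists (Ordinal ln); exact: val_inj.
Qed.

Lemma stay_cost : social_cost stay_routing = n%:R * k.
Proof.
rewrite /social_cost big_split_ord/= [X in _ + X]big1 => [|i _]; last first.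
  by rewrite [X in _ * X]latency_link mulr0.
rewrite addr0 big_ord_recr/= [X in _ + X * _]stay_total_max mul0r addr0.
under eq_bigr => j _.
  rewrite [X in X * _]stay_total [X in _ * X]stay_latency.
  rewrite mulrCA mulVf ?gt_eqF ?growthX_gt0//.
  rewrite mulr1; over.
by rewrite sumr_const card_ord mulr_natl.
Qed.

(** Exit j + 1 < n carries only type j, at slope g^(2j+2), so flow times latency is g^(-2j) g^(2j+2)
    = g^2. The last commodity meets the constant latency (k + 1) g^n and costs (k + 1) g = 2k. *)
Lemma advance_cost : social_cost advance_routing <= n%:R * g ^+ 2 + 2 * k.
Proof.
rewrite /social_cost big_split_ord/= [X in _ + X]big1 => [|i _]; last first.
  by rewrite [X in _ * X]latency_link mulr0.
(* Exit 0 is left empty, so the sum over exits is reindexed by the commodity that arrives at each of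
   the others. *)
rewrite addr0 big_ord_recl/= [X in X * _ + _ <= _]big1 => [|j _]; last first.
  by rewrite advance_exit.
rewrite mul0r add0r.
apply: le_trans (sum_ord_if_last n _ _); last 2 first.
- by rewrite exprn_ge0 ?(ltW growth_gt0).
- by rewrite mulr_ge0 ?(ltW k_gt0).
apply: ler_sum => j _.
rewrite (eq_bigr (fun j' : 'I_n => if j == j' :> nat then (g ^+ j')^-1 else 0))
  => [|j' _]; last first.
  by rewrite advance_exit /= /bump leq0n add1n eqSS.
rewrite sum_ord_if_eq [X in _ * X]latencyE offset_exit.
rewrite (eq_bigr (fun j' : 'I_n => if j == j' :> nat then
   (if (j'.+1 < n)%N then g ^+ j'.+1 ^+ 2 else 0) * (g ^+ j')^-1 else 0))
  => [|j' _]; last first.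
  rewrite advance_exit slope_exit /= /bump leq0n add1n eqSS.
  have [/val_inj ->|_] := eqVneq (val j) (val j'); last by rewrite !mulr0.
  (* The type using exit j + 1 is j, not j + 1, so the factor of the slope is 1 and not k. *)
  by rewrite gtn_eqF// mul1r.
rewrite sum_ord_if_eq /= /bump leq0n add1n.
have gj := growthX_gt0 j; case: ltnP => jn.
  by rewrite [g ^+ j.+1]exprS addr0 le_eqVlt; apply/orP; left;
    apply/eqP; field; rewrite gt_eqF.
have nj : n = j.+1 by apply/eqP; rewrite eqn_leq jn ltn_ord.
have -> : g ^+ n = g * g ^+ j by rewrite -exprS -nj.
by rewrite mul0r add0r [(k + 1) * _]mulrA k1_growth mulrC mulfK ?gt_eqF.
Qed.

(** * Staying is an equilibrium *)

Lemma stay_exit_cost_ge (r : 'I_n) (l : 'I_n.+1) : (r <= l)%N ->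
  2 * k * g ^+ r <= latency (exit_road l) (row (exit_road l) stay_routing) +
    (\sum_(j < n) stay_routing (exit_road l) j) * chain_slope (exit_road l) r.
Proof.
(* An exit m > r costs (k + 1) g^m in total, toll included. At m = r + 1 this is exactly the 2k g^r
   paid at exit r, and it is nondecreasing in m because g >= 1. *)
have gk m : (r < m)%N -> 2 * k * g ^+ r <= (k + 1) * g ^+ m.
  move=> rm; rewrite -k1_growth -mulrA -exprS ler_wpM2l ?ler_weXn2l ?growth_ge1//.
  by move: k_ge1; lra.
have [->|[j ->]] := ord_wid l.
  by rewrite stay_latency_max stay_total_max mul0r addr0 => _; exact: gk.
rewrite stay_latency stay_total slope_exit /= ltn_ord => rj.
have gj := growthX_gt0 j; rewrite [X in _ <= _ + X](_ : _ =
   (if j == r :> nat then k else 1) * g ^+ j); last by field; rewrite gt_eqF.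
rewrite -mulrDl; case: eqP => [->|/eqP jr].
  by rewrite -[k + k]mulr2n -[k *+ 2]mulr_natl.
by apply: gk; rewrite ltn_neqAle eq_sym jr.
Qed.

Lemma stay_equilibrium : wardrop_equilibrium (@marginal_cost_tolls R chain) stay_routing.
Proof.
exists (pure_flow stay); split => // [|r p p' _ p'P].
  exact: (feasible_pure_flow comm_path_stay).
rewrite /pure_flow; case: eqP => [-> _|_]; last by rewrite ltxx.
rewrite !path_cost_marginal/= big_seq1 [X in X + _]stay_latency.
rewrite [X in _ + X * _]stay_total slope_exit /= ltn_ord eqxx.
(* Any rival path contains some exit at or beyond r, which alone costs at least as much as staying;
   its other roads add nonnegative costs. *)
have [l lp' rl] := comm_path_exit p'P.
rewrite (big_rem _ lp')/=.
have := stay_exit_cost_ge rl.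
rewrite [X in X <= _ -> _](_ : _ = k * g ^+ r + (g ^+ r)^-1 * (k * g ^+ r ^+ 2)); last first.
  by field; rewrite gt_eqF ?growthX_gt0.
move=> /le_trans; apply; rewrite lerDl.
apply: sumr_ge0 => i _.
have z_ge0 i' j : 0 <= stay_routing i' j.
  rewrite (induced_pure_flow comm_path_stay) sumr_ge0// => r' _.
  exact: chain_demand_ge0.
rewrite latencyE !addr_ge0 ?chain_offset_ge0//.
  by rewrite sumr_ge0// => j _; rewrite mulr_ge0 ?chain_slope_ge0.
by rewrite mulr_ge0 ?chain_slope_ge0 ?sumr_ge0.
Qed.

(** Commodity 0 has positive demand, so one of its paths carries flow and crosses an exit. That exit
    has positive flow, hence positive latency: through its slope if l < n, through its offset if l =
    n. *)
Lemma chain_social_cost_gt0 (z : routing chain) :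
  (0 < n)%N -> feasible z -> 0 < social_cost z.
Proof.
move=> n_gt0 [f [f_ge0 f_sum] zE].
have z_ge0 i j : 0 <= z i j.
  rewrite zE mxE sumr_ge0// => r _; rewrite sumr_ge0// => p /andP[+ _].
  exact: f_ge0.
have lat_ge0 i : 0 <= latency i (row i z).
  rewrite latencyE addr_ge0 ?chain_offset_ge0//.
  by rewrite sumr_ge0// => j _; rewrite mulr_ge0 ?chain_slope_ge0.
pose r : 'I_(ncomm chain) := Ordinal n_gt0.
have [p pr fp] : exists2 p, comm_path r p & 0 < f r p.
  apply/exists2P/not_existsP => f_le0.
  have : 0 < \sum_(p | comm_path r p) f r p by rewrite f_sum /= invr_gt0 growthX_gt0.
  rewrite ltNge sumr_le0// => p pr; rewrite leNgt; apply/negP => fp.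
  exact: (f_le0 p).
have [l lp _] := comm_path_exit pr.
have zl : 0 < z (exit_road l) r.
  rewrite zE mxE (big_pred1 r)// (bigD1 p) ?pr//= ltr_pwDl// sumr_ge0// => q.
  by move=> /andP[/andP[+ _] _]; exact: f_ge0.
rewrite /social_cost (bigD1 (exit_road l))//= ltr_pwDl ?sumr_ge0// => [|i _]; last first.
  by rewrite mulr_ge0// sumr_ge0.
rewrite mulr_gt0//; first by rewrite (bigD1 r)//= ltr_pwDl ?sumr_ge0.
rewrite latencyE offset_exit; case: ltnP => ln; last first.
  rewrite ltr_wpDl ?sumr_ge0// => [j _|]; first by rewrite mulr_ge0 ?chain_slope_ge0.
  by rewrite mulr_gt0 ?growthX_gt0//; move: k_ge1; lra.
rewrite addr0 (bigD1 r)//= ltr_pwDl ?sumr_ge0// => [|j _]; last first.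
  by rewrite mulr_ge0 ?chain_slope_ge0.
rewrite mulr_gt0// slope_exit ln mulr_gt0 ?exprn_gt0 ?growth_gt0//.
by case: ifP => _; rewrite ?k_gt0.
Qed.

(** * Degree of asymmetry of the chain *)

Lemma slope_exit_ratio (l : 'I_n.+1) (j j' : 'I_n) : (l < n)%N ->
  @slope_ratio R chain (exit_road l) j j' =
  ((if l == j :> nat then k else 1) / (if l == j' :> nat then k else 1))%:E.
Proof.
move=> ln; have w_gt0 : 0 < g ^+ l ^+ 2 by rewrite exprn_gt0 ?growthX_gt0.
have c_gt0 (j0 : 'I_n) : 0 < (if l == j0 :> nat then k else 1).
  by case: ifP => _; rewrite ?k_gt0.
rewrite /slope_ratio /=; case: forallP => [/(_ j)|_].
  by rewrite slope_exit ln mulf_eq0 (gt_eqF (c_gt0 j)) (gt_eqF w_gt0).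
rewrite !slope_exit ln; move: (c_gt0 j) (c_gt0 j').
move: (if _ then _ else _) (if _ then _ else _) => c c' c_gt0' c'_gt0.
by rewrite inver mulf_eq0 !gt_eqF//= -EFinM invfM mulrACA divff ?mulr1 ?gt_eqF.
Qed.

Lemma slope_ratio_le (i : 'I_(nroads chain)) (j j' : 'I_(ntypes chain)) :
  (slope_ratio i j j' <= k%:E)%E.
Proof.
have slope0 : (forall j, chain_slope i j = 0) -> (slope_ratio i j j' <= k%:E)%E.
  move=> i0; rewrite /slope_ratio /=; case: forallP => [_|]; first by rewrite lee_fin.
  by case=> j0; rewrite i0.
case: (split_ordP i) => l il; last first.
  by apply: slope0 => j0; rewrite il -[rshift _ _]/(link l) slope_link.
have [ln|nl] := ltnP l n; last first.
  by apply: slope0 => j0; rewrite il -[lshift _ _]/(exit_road l) slope_exit ltnNge nl.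
rewrite il -[lshift _ _]/(exit_road l) slope_exit_ratio// lee_fin ler_pdivrMr; last first.
  by case: ifP => _; rewrite ?k_gt0.
by do 2 case: ifP => _; move: k_ge1; nra.
Qed.

(** The ratio k is attained at exit 0 between types 0 and 1, whence the need for two types. *)
Lemma max_asymmetry_chain : (1 < n)%N -> max_asymmetry chain = k%:E.
Proof.
move=> n_gt1; apply/le_anti/andP; split.
  by do 3! (apply: bigmax_le => [|? _]; first by rewrite lee_fin); exact: slope_ratio_le.
have n_gt0 : (0 < n)%N by exact: ltn_trans n_gt1.
rewrite /max_asymmetry.
apply: (bigmax_sup (exit_road ord0)) => //; apply: (bigmax_sup (Ordinal n_gt0)) => //.
apply: (bigmax_sup (Ordinal n_gt1)) => //.
by rewrite slope_exit_ratio//= divr1.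
Qed.

(** The optimum stays unknown: its cost is at most that of [advance_routing], which only makes the
    true ratio larger. *)
Lemma chain_ratio_le_price : (1 < n)%N ->
  ((n%:R * k / (n%:R * g ^+ 2 + 2 * k))%:E <=
   price_of_anarchy (fun G : game R => max_asymmetry G = k%:E)
                    (fun G : game R => @marginal_cost_tolls R G))%E.
Proof.
move=> n_gt1; have n_gt0 : (0 < n)%N by exact: ltn_trans n_gt1.
have advance_feasible : feasible advance_routing.
  by exists (pure_flow advance) => //; exact: (feasible_pure_flow comm_path_advance).
have [z zopt] := @exists_socially_optimal _ _ _ advance_feasible.
have z_gt0 := chain_social_cost_gt0 n_gt0 zopt.1.
apply: (@le_trans _ _ (social_cost stay_routing / social_cost z)%:E).
  rewrite stay_cost lee_fin ler_wpM2l ?mulr_ge0 ?(ltW k_gt0)// lef_pV2 ?posrE//.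
    exact: le_trans (zopt.2 _ advance_feasible) advance_cost.
  by rewrite ltr_wpDl// ?mulr_gt0 ?k_gt0// mulr_ge0 ?exprn_ge0 ?(ltW growth_gt0).
apply: ereal_sup_ubound; exists chain, stay_routing, z; split => //.
- exact: max_asymmetry_chain.
- exact: stay_equilibrium.
Qed.
End Chain.

(** * Comparison with the square-root bound, and the limit of long chains *)

Lemma sqrt_bound_le_growth (R : realType) (k : R) : 1 <= k ->
  k / (2 * Num.sqrt k - 1) <= k / growth k ^+ 2.
Proof.
move=> k1; have k0 : 0 <= k by exact: le_trans k1.
have s1 : 1 <= Num.sqrt k by rewrite -[1]sqrtr1 ler_wsqrtr.
have sE := sqr_sqrtr k0.
have g_gt0 := growth_gt0 k1.
rewrite ler_wpM2l// lef_pV2 ?posrE ?exprn_gt0//; last by lra.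
rewrite /growth expr_div_n ler_pdivrMr; last by rewrite exprn_gt0//; lra.
move: (Num.sqrt k) s1 sE => s s1 <-.
(* With s the square root of k, the claim has become (2 s^2)^2 <= (2s - 1)(s^2 + 1)^2. Equality
   holds at s = 1, and expanding around it leaves a polynomial in t with nonnegative
   coefficients. *)
have [t t0 ->] : exists2 t, 0 <= t & s = 1 + t by exists (s - 1); [lra | ring].
rewrite -subr_ge0 [X in 0 <= X](_ : _ = t ^+ 3 * (4 + 5 * t + 2 * t ^+ 2)); last by ring.
by rewrite mulr_ge0 ?exprn_ge0// !addr_ge0 ?mulr_ge0 ?exprn_ge0.
Qed.

Theorem proposition4 (R : realType) (k : R) (k_ge1 : 1 <= k) :
  ((k / (2 * Num.sqrt k - 1))%:E <=
   price_of_anarchy (fun G : game R => max_asymmetry G = k%:E)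
                    (fun G : game R => @marginal_cost_tolls R G))%E.
Proof.
apply: (@le_trans _ _ (k / growth k ^+ 2)%:E).
  by rewrite lee_fin sqrt_bound_le_growth.
apply/lee_addgt0Pr => e e_gt0.
have g_ge1 := growth_ge1 k_ge1.
have g2_ge1 : 1 <= growth k ^+ 2 by rewrite exprn_ege1.
(* With x = g^2, the chain of length n misses k / x by 2k^2 / (x (n x + 2k)), which is at most 2k^2
   / n since x >= 1; n is chosen to push this below [e]. The [.+2] ensures 1 < n, so that the
   asymmetry is exactly k. *)
set n := (Num.bound (2 * k ^+ 2 / e)).+2.
have n_ge : 2 * k ^+ 2 <= n%:R * e.
  rewrite -ler_pdivrMr//; apply: (@le_trans _ _ (Num.bound (2 * k ^+ 2 / e))%:R).
    by rewrite ltW// archi_boundP// divr_ge0 ?ltW// mulr_gt0 ?exprn_gt0//; lra.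
  by rewrite ler_nat ltnW.
apply: (@le_trans _ _ (n%:R * k / (n%:R * growth k ^+ 2 + 2 * k) + e)%:E); last first.
  by rewrite EFinD leeD2r// chain_ratio_le_price.
have n_ge1 : 1 <= n%:R :> R by rewrite ler1n.
rewrite lee_fin; move: (growth k ^+ 2) g2_ge1 => x x_ge1.
have D_gt0 : 0 < n%:R * x + 2 * k by nra.
rewrite -lerBlDl (_ : _ - _ = 2 * k ^+ 2 / (x * (n%:R * x + 2 * k))); last first.
  by field; apply/andP; split; rewrite gt_eqF//; lra.
rewrite ler_pdivrMr; last by rewrite mulr_gt0//; lra.
apply: le_trans n_ge _; rewrite mulrC ler_wpM2l ?(ltW e_gt0)//.
nra.
Qed.
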